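(* Let $q$ be a complex number with $0<|q|<1$, let $N\ge 0$ be an integer, and let $A,B,C,D,E$ be nonzero complex numbers such that all denominators below are nonzero. For nonzero complex $A',C'$ define the truncated very-well-poised ${}_6\psi_6$ series $$\mathbf{S}_N(A';C'):=\sum_{n=-N}^{N} \frac{1-BDEq^{2n+1}/A'}{1-BDEq/A'}\,\frac{(Bq,\,Dq,\,Eq,\,BC'DEq^2/A'^2;q)_n}{(DEq/A',\,BEq/A',\,BDq/A',\,A'/C';q)_n}\Big(\frac{1}{C'q^2}\Big)^n,$$ where $B,D,E$ are kept fixed. Then $$\mathbf{S}_{N+1}(A;C)=\frac{K_N(A;B,C,D,E)}{(Cq^3)^{N}}+\frac{A^2q}{BDE}\,\frac{\nabla(BDE/A,\,Cq^3,\,BD/A,\,BE/A,\,DE/A)}{\nabla(BDEq/A,\,BCDEq/A^2,\,Aq/B,\,Aq/D,\,Aq/E)}\,\mathbf{S}_{N}(Aq;Cq),$$ where $$\begin{aligned}K_N(A;B,C,D,E):=&\ \frac{q^{N-2}\,\nabla(BDEq^{2N+3}/A)\,(Bq,Dq,Eq,BCDEq^2/A^2;q)_{N+1}}{C\,\nabla(BDEq/A)\,(A/C,BDq/A,BEq/A,DEq/A;q)_{N+1}}\\ &+\frac{BDE\,\nabla(q^{N-1}/A)\,(A/(BD),A/(BE),A/(DE),C/A;q)_{N+2}}{C\,\nabla(C/A,Aq/B,Aq/D,Aq/E,BDEq/A)\,(1/B,1/D,1/E,A^2/(BCDEq);q)_{N+1}}\\ &-\frac{A^2q}{BDE}\,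\frac{\nabla(Bq,Dq,Eq,BDEq^{N-1}/A^2)\,(BCDEq^2/A^2,Bq^2,Dq^2,Eq^2;q)_{N}}{\nabla(Aq/B,Aq/D,Aq/E,BDEq/A)\,(A/C,BDq/A,BEq/A,DEq/A;q)_{N}}.\end{aligned}$$
   Context: Notation: $\nabla(x):=1-x$ and $\nabla(x_1,\dots,x_n):=\prod_{i=1}^n(1-x_i)$. The $q$-shifted factorial is $(a;q)_n=(1-a)(1-aq)\cdots(1-aq^{n-1})$ for $n\ge1$, $(a;q)_0=1$, and $(a;q)_n=\big((1-aq^{-1})(1-aq^{-2})\cdots(1-aq^{n})\big)^{-1}$ for $n\le -1$; also $(x_1,\dots,x_m;q)_n:=\prod_{i=1}^m(x_i;q)_n$. In the statement, $\mathbf{S}_N(Aq;Cq)$ denotes the defined sum with $A'=Aq$, $C'=Cq$ and the same $B,D,E$. *)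

(* Defs.v *)
From HB Require Import structures.
From mathcomp Require Export all_boot all_order all_algebra.
From mathcomp Require Export reals complex.

Set Implicit Arguments.
Unset Strict Implicit.
Unset Printing Implicit Defensive.

Import Order.TTheory GRing.Theory Num.Theory.
Local Open Scope ring_scope.

Definition nabla (F : fieldType) (x : F) : F := 1 - x.

Definition nablas (F : fieldType) (xs : seq F) : F := \prod_(x <- xs) nabla x.

(* The denominator occurring in the definition of (a;q)_n: empty for n >= 0,
   (1 - a q^-1) ... (1 - a q^n) for n <= -1; recall Negz m = - (m + 1). *)
Definition qfact_den (F : fieldType) (q a : F) (n : int) : F :=
  match n with
  | Posz _ => 1
  | Negz m => \prod_(i < m.+1) (1 - a * q ^- i.+1)
  end.

Definition qfact (F : fieldType) (q a : F) (n : int) : F :=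
  match n with
  | Posz m => \prod_(i < m) (1 - a * q ^+ i)
  | Negz _ => (qfact_den q a n)^-1
  end.

Definition qfacts (F : fieldType) (q : F) (xs : seq F) (n : int) : F :=
  \prod_(x <- xs) qfact q x n.

Definition truncS_upper (F : fieldType) (q B D E A C : F) : seq F :=
  [:: B * q; D * q; E * q; B * C * D * E * q ^+ 2 / A ^+ 2].

Definition truncS_lower (F : fieldType) (q B D E A C : F) : seq F :=
  [:: D * E * q / A; B * E * q / A; B * D * q / A; A / C].

Definition truncS_term (F : fieldType) (q B D E A C : F) (n : int) : F :=
  (1 - B * D * E * q ^ (2 * n + 1) / A) / (1 - B * D * E * q / A)
  * (qfacts q (truncS_upper q B D E A C) n / qfacts q (truncS_lower q B D E A C) n)
  * (1 / (C * q ^+ 2)) ^ n.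

Definition truncS (F : fieldType) (q B D E : F) (N : nat) (A C : F) : F :=
  \sum_(i < (2 * N).+1) truncS_term q B D E A C (i%:Z - N%:Z).

(* All denominators of truncS are nonzero, including those hidden in the q-shifted
   factorials of negative index. Those built only from q, A and C are left out,
   as q, A and C are assumed nonzero wherever this is used. *)
Definition truncS_defined (F : fieldType) (q B D E : F) (N : nat) (A C : F) : Prop :=
  1 - B * D * E * q / A != 0 /\
  forall n : int, - N%:Z <= n <= N%:Z ->
    (forall x, x \in truncS_upper q B D E A C ++ truncS_lower q B D E A C ->
       qfact_den q x n != 0) /\
    qfacts q (truncS_lower q B D E A C) n != 0.

Definition K_den1 (F : fieldType) (q : F) (N : nat) (A B C D E : F) : F :=
  C * nabla (B * D * E * q / A)
  * qfacts q [:: A / C; B * D * q / A; B * E * q / A; D * E * q / A] N.+1.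

Definition K_den2 (F : fieldType) (q : F) (N : nat) (A B C D E : F) : F :=
  C * nablas [:: C / A; A * q / B; A * q / D; A * q / E; B * D * E * q / A]
  * qfacts q [:: 1 / B; 1 / D; 1 / E; A ^+ 2 / (B * C * D * E * q)] N.+1.

Definition K_den3 (F : fieldType) (q : F) (N : nat) (A B C D E : F) : F :=
  nablas [:: A * q / B; A * q / D; A * q / E; B * D * E * q / A]
  * qfacts q [:: A / C; B * D * q / A; B * E * q / A; D * E * q / A] N.

Definition K (F : fieldType) (q : F) (N : nat) (A B C D E : F) : F :=
  q ^ (N%:Z - 2) * nabla (B * D * E * q ^+ (2 * N + 3) / A)
    * qfacts q [:: B * q; D * q; E * q; B * C * D * E * q ^+ 2 / A ^+ 2] N.+1
    / K_den1 q N A B C D E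
  + B * D * E * nabla (q ^ (N%:Z - 1) / A)
    * qfacts q [:: A / (B * D); A / (B * E); A / (D * E); C / A] N.+2
    / K_den2 q N A B C D E
  - A ^+ 2 * q / (B * D * E)
    * (nablas [:: B * q; D * q; E * q; B * D * E * q ^ (N%:Z - 1) / A ^+ 2]
       * qfacts q [:: B * C * D * E * q ^+ 2 / A ^+ 2;
                      B * q ^+ 2; D * q ^+ 2; E * q ^+ 2] N
       / K_den3 q N A B C D E).

Definition K_defined (F : fieldType) (q : F) (N : nat) (A B C D E : F) : Prop :=
  [/\ K_den1 q N A B C D E != 0, K_den2 q N A B C D E != 0
    & K_den3 q N A B C D E != 0].

(* Main.v *)
(** With a = BDEq/A, (b, d, e) = (Bq, Dq, Eq) and u = BCDEq^2/A^2, the summand t_n of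
    S(A; C) is the very-well-poised term of parameters (a; b, d, e, u), of argument
    a^2 q/(bdeu) = 1/(Cq^2), and the summand t'_n of S(Aq; Cq) is the one of
    (a/q; b, d, e, u/q).  There are two products J_n (lower boundary) and H_n (upper
    boundary) such that t_n = J_n - H_n and J_(n+1) = H_n + c t'_(n+1), where c is
    the coefficient of S(Aq; Cq); each relation amounts to a polynomial identity in
    q^n.  Hence the sum of t_n over -N-1 <= n <= N is J_(-N-1) - H_N plus c times the
    sum of t'_n over -N <= n <= N.  The summands of K_N, divided by (Cq^3)^N, are
    t_(N+1), J_(-N-1) after reflection of (x; q)_(-n) into (q/x; q)_n, and -H_N. *)
Require Import Defs.
From mathcomp Require Import ring zify.
Import Order.TTheory GRing.Theory Num.Theory.
Local Open Scope ring_scope.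

Section QFactorial.

Context {F : fieldType}.
Variable q : F.

Lemma qfactSr (x : F) (n : nat) : qfact q x n.+1 = qfact q x n * (1 - x * q ^+ n).
Proof. by rewrite /= big_ord_recr. Qed.

Lemma qfactSl (x : F) (n : nat) : qfact q x n.+1 = (1 - x) * qfact q (x * q) n.
Proof.
rewrite /= big_ord_recl expr0 mulr1; congr (_ * _).
by apply: eq_bigr => i _; rewrite -mulrA -exprS.
Qed.

Lemma qfactSzr (x : F) (n : int) : qfact_den q x n != 0 ->
  qfact q x (n + 1) = qfact q x n * (1 - x * q ^ n).
Proof.
case: n => [m _|[|m]]; first by rewrite -PoszD addn1 qfactSr.
  by rewrite /= big_ord1 big_ord0 => h; rewrite mulVf.
have -> : Negz m.+1 + 1 = Negz m by rewrite !NegzE; lia.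
by rewrite /= big_ord_recr /= mulf_eq0 negb_or => /andP[_ h]; rewrite invfM mulfVK.
Qed.

Hypothesis q0 : q != 0.

Lemma qfactSzl (x : F) (n : int) : 1 - x != 0 ->
  qfact q x (n + 1) = (1 - x) * qfact q (x * q) n.
Proof.
move=> x1.
have shiftV k : x * q * q ^- k.+1 = x * q ^- k.
  by rewrite exprS; field; rewrite q0 expf_neq0.
case: n => [m|[|m]].
- by rewrite -PoszD addn1 qfactSl.
- by rewrite /= big_ord1 big_ord0 shiftV invr1 mulr1 mulfV.
have -> : Negz m.+1 + 1 = Negz m by rewrite !NegzE; lia.
rewrite /= [in RHS]big_ord_recl shiftV invr1 mulr1 invfM mulVKf //.
by congr (_^-1); apply: eq_bigr => i _; rewrite shiftV.
Qed.

Lemma qfact_opp (x : F) (n : nat) : x != 0 ->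
  qfact q x (- n%:Z) = \prod_(i < n) (- q ^+ i) * (q / x) ^+ n / qfact q (q / x) n.
Proof.
move=> x0; case: n => [|n]; first by rewrite oppr0 /= !big_ord0 expr0 divr1 mulr1.
rewrite -NegzE /= -[X in _ ^+ X](card_ord n.+1) -prodr_const.
rewrite -!prodfV -!big_split /=; apply: eq_bigr => i _.
have -> : 1 - q / x * q ^+ i = - q ^+ i * (q / x) * (1 - x * q ^- i.+1).
  by rewrite exprS; field; rewrite q0 x0 expf_neq0.
by rewrite [in RHS]invfM mulVKf // !mulf_neq0 ?oppr_eq0 ?invr_eq0 ?expf_neq0.
Qed.

End QFactorial.

Section WellPoisedQuotient.

Context {F : fieldType}.
Variable q : F.

Definition wp_quot (a x : F) (n : int) : F := qfact q x n / qfact q (a * q / x) n.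

Definition wp_defined (a x : F) (n : int) : Prop :=
  [/\ qfact_den q x n != 0, qfact_den q (a * q / x) n != 0
    & qfact q (a * q / x) n != 0].

Lemma wp_defined_factor_neq0 (a x : F) (n : int) :
  wp_defined a x (n + 1) -> wp_defined a x n -> 1 - a * q / x * q ^ n != 0.
Proof.
move=> [_ _ low] [_ den _]; move: low.
by rewrite qfactSzr // mulf_eq0 negb_or => /andP[].
Qed.

Lemma wp_quotSz (a x : F) (n : int) : wp_defined a x n ->
  wp_quot a x (n + 1) = wp_quot a x n * ((1 - x * q ^ n) / (1 - a * q / x * q ^ n)).
Proof. by move=> [up low _]; rewrite /wp_quot !qfactSzr // mulf_div. Qed.

Hypothesis q0 : q != 0.

Lemma wp_defined_ratio_neq0 (a x : F) : wp_defined a x (-1) -> 1 - a / x != 0.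
Proof. by case=> _; rewrite /= big_ord1 expr1 mulrAC mulfK. Qed.

Lemma wp_quotSz_contiguous (a x : F) (n : int) : wp_defined a x n -> 1 - a / x != 0 ->
  wp_quot (a / q) x (n + 1) = wp_quot a x n * ((1 - x * q ^ n) / (1 - a / x)).
Proof.
move=> [up _ _] ax; rewrite /wp_quot divfK // qfactSzr // qfactSzl //.
by rewrite [a / x * q]mulrAC [X in _ / X = _]mulrC mulf_div.
Qed.

Lemma wp_quotSz_contiguous_shift (a x : F) (n : int) :
  wp_defined a x n -> 1 - x / q != 0 ->
  wp_quot (a / q) (x / q) (n + 1)
  = wp_quot a x n * ((1 - x / q) / (1 - a * q / x * q ^ n)).
Proof.
move=> [_ low _] xq; rewrite /wp_quot divfK // qfactSzl // divfK //.
by rewrite invf_div mulrA qfactSzr // [(1 - _) * _]mulrC mulf_div.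
Qed.

Lemma wp_quot_opp (a x : F) (n : nat) : a != 0 -> x != 0 ->
  wp_quot a x (- n%:Z)
  = (a * q / x ^+ 2) ^+ n * (qfact q (x / a) n / qfact q (q / x) n).
Proof.
move=> a0 x0; have s0 : \prod_(i < n) (- q ^+ i) != 0.
  by apply/prodf_neq0 => i _; rewrite oppr_eq0 expf_neq0.
rewrite /wp_quot !qfact_opp ?mulf_neq0 ?invr_eq0 //.
have -> : q / (a * q / x) = x / a by field; rewrite q0 a0 x0.
have -> : a * q / x ^+ 2 = q / x / (x / a) by field; rewrite a0 x0.
rewrite [in RHS]expr_div_n invf_div mulrAC mulrCA -mulf_div mulfV // mul1r.
by rewrite mulrAC mulrC.
Qed.

End WellPoisedQuotient.

Section VeryWellPoised.

Context {F : fieldType}.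
Variable q : F.

Definition vwp_term (a b d e u : F) (n : int) : F :=
  (1 - a * (q ^ n) ^+ 2) / (1 - a)
  * (wp_quot q a b n * wp_quot q a d n * wp_quot q a e n * wp_quot q a u n)
  * (a ^+ 2 * q / (b * d * e * u)) ^ n.

Definition vwp_defined (a b d e u : F) (n : int) : Prop :=
  [/\ wp_defined q a b n, wp_defined q a d n, wp_defined q a e n & wp_defined q a u n].

Definition contiguity_weight (a b d e : F) : F :=
  b * d * e / a ^+ 2 / ((1 - a) * (1 - b * d / a) * (1 - b * e / a) * (1 - d * e / a)).

Definition contiguity_coef (a b d e u : F) : F :=
  contiguity_weight a b d e
  * ((1 - a / q) * (1 - b * d * e * u / a ^+ 2)
     * (1 - a / b) * (1 - a / d) * (1 - a / e) / (1 - u / q)).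

Definition boundary_core (a b d e u : F) (n : int) : F :=
  contiguity_weight a b d e
  * (wp_quot q a b n * wp_quot q a d n * wp_quot q a e n * wp_quot q a u n)
  * (a ^+ 2 / (b * d * e * u)) ^ n.

Definition upper_boundary (a b d e u : F) (n : int) : F :=
  boundary_core a b d e u n
  * ((1 - a ^+ 2 / (b * d * e) * q ^ n)
     * ((1 - b * q ^ n) * (1 - d * q ^ n) * (1 - e * q ^ n))).

Definition lower_boundary (a b d e u : F) (n : int) : F :=
  boundary_core a b d e u n
  * ((1 - b * d * e / a * q ^ n)
     * ((1 - a / b * q ^ n) * (1 - a / d * q ^ n) * (1 - a / e * q ^ n))).

Variables (a b d e u : F).
Hypotheses (q0 : q != 0) (a0 : a != 0).
Hypotheses (b0 : b != 0) (d0 : d != 0) (e0 : e != 0) (u0 : u != 0).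

Let parameter_neq0 := (q0, a0, b0, d0, e0, u0).

Lemma boundary_identity (x : F) :
  (1 - b * d * e / a * x) * ((1 - a / b * x) * (1 - a / d * x) * (1 - a / e * x))
  - (1 - a ^+ 2 / (b * d * e) * x) * ((1 - b * x) * (1 - d * x) * (1 - e * x))
  = a ^+ 2 / (b * d * e) * x * (1 - a * x ^+ 2)
    * ((1 - b * d / a) * (1 - b * e / a) * (1 - d * e / a)).
Proof. by field; rewrite !parameter_neq0. Qed.

Lemma vwp_term_boundary (n : int) :
  nablas [:: a; b * d / a; b * e / a; d * e / a] != 0 ->
  vwp_term a b d e u n = lower_boundary a b d e u n - upper_boundary a b d e u n.
Proof.
rewrite /nablas !big_cons big_nil mulr1 mulf_eq0 negb_or /nabla mulrA.
move=> /andP[a1 nabla_neq0].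
rewrite -mulrBr boundary_identity /vwp_term /boundary_core /contiguity_weight.
have -> : (a ^+ 2 * q / (b * d * e * u)) ^ n
  = (a ^+ 2 / (b * d * e * u)) ^ n * q ^ n by rewrite -expfzMl mulrAC.
rewrite -!(mulrA (1 - a)); move: nabla_neq0.
move: (_ * wp_quot q a u n) (_ * (1 - d * e / a)) => P V V0.
by field; rewrite !parameter_neq0 V0 a1.
Qed.

Lemma contiguity_identity (x : F) :
  (1 - b * d * e / a * (q * x)) * (1 - u * x)
  = (1 - b * d * e * u / a ^+ 2) * (1 - a / q * (q * x) ^+ 2)
    + (1 - a ^+ 2 / (b * d * e) * x) * (1 - a * q / u * x) * (b * d * e * u / a ^+ 2).
Proof. by field; rewrite !parameter_neq0. Qed.

Let base_neq0 : a ^+ 2 / (b * d * e * u) != 0.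
Proof. by rewrite !mulf_neq0 ?invr_eq0 ?mulf_neq0. Qed.

Lemma lower_boundarySz (n : int) :
  vwp_defined a b d e u n -> vwp_defined a b d e u (n + 1) ->
  lower_boundary a b d e u (n + 1)
  = boundary_core a b d e u n * ((1 - b * q ^ n) * (1 - d * q ^ n) * (1 - e * q ^ n))
    * (a ^+ 2 / (b * d * e * u) / (1 - a * q / u * q ^ n))
    * ((1 - b * d * e / a * (q * q ^ n)) * (1 - u * q ^ n)).
Proof.
move=> [hb hd he hu] [/wp_defined_factor_neq0-/(_ hb) nb].
move=> /wp_defined_factor_neq0-/(_ hd) nd /wp_defined_factor_neq0-/(_ he) ne.
move=> /wp_defined_factor_neq0-/(_ hu) nu.
rewrite /lower_boundary /boundary_core !wp_quotSz // !expfzDr // !expr1z.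
have shift_factor x : a / x * (q ^ n * q) = a * q / x * q ^ n by ring.
rewrite !shift_factor [q ^ n * q]mulrC.
move: (1 - a * q / b * q ^ n) nb => Nb nb; move: (1 - a * q / d * q ^ n) nd => Nd nd.
move: (1 - a * q / e * q ^ n) ne => Ne ne; move: (1 - a * q / u * q ^ n) nu => Nu nu.
move: (a ^+ 2 / (b * d * e * u)) => w.
by field; rewrite a0 nb nd ne nu.
Qed.

Lemma contiguous_vwp_termSz (n : int) : vwp_defined a b d e u n ->
  nablas [:: a / q; a / b; a / d; a / e; u / q] != 0 ->
  contiguity_coef a b d e u * vwp_term (a / q) b d e (u / q) (n + 1)
  = boundary_core a b d e u n * ((1 - b * q ^ n) * (1 - d * q ^ n) * (1 - e * q ^ n))
    * (a ^+ 2 / (b * d * e * u) / (1 - a * q / u * q ^ n))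
    * ((1 - b * d * e * u / a ^+ 2) * (1 - a / q * (q * q ^ n) ^+ 2)).
Proof.
move=> [hb hd he hu]; rewrite /nablas !big_cons big_nil mulr1 !mulf_eq0 !negb_or.
move=> /and5P[naq nab nad nae nuq].
rewrite /vwp_term wp_quotSz_contiguous_shift // !wp_quotSz_contiguous //.
have -> : (a / q) ^+ 2 * q / (b * d * e * (u / q)) = a ^+ 2 / (b * d * e * u).
  by field; rewrite !parameter_neq0.
rewrite !expfzDr // !expr1z [q ^ n * q]mulrC /contiguity_coef /boundary_core.
rewrite -![1 - _ / _]/(nabla _).
move: (nabla (a / q)) naq (nabla (a / b)) nab (nabla (a / d)) nad => Na na Nb nb Nd nd.
move: (nabla (a / e)) nae (nabla (u / q)) nuq => Ne ne Nu nu.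
move: (a ^+ 2 / (b * d * e * u)) (1 - a * q / u * q ^ n)^-1 => w r.
by field; rewrite q0 ne nd nb na nu.
Qed.

Lemma lower_boundary_contiguous (n : int) :
  vwp_defined a b d e u n -> vwp_defined a b d e u (n + 1) ->
  nablas [:: a / q; a / b; a / d; a / e; u / q] != 0 ->
  lower_boundary a b d e u (n + 1)
  = upper_boundary a b d e u n
    + contiguity_coef a b d e u * vwp_term (a / q) b d e (u / q) (n + 1).
Proof.
move=> def_n def_Sn nabla_neq0.
have [[_ _ _ hu] [_ _ _ /wp_defined_factor_neq0-/(_ hu) nu]] := (def_n, def_Sn).
rewrite lower_boundarySz // contiguous_vwp_termSz // contiguity_identity.
rewrite mulrDr addrC /upper_boundary; congr (_ + _).
move: (boundary_core _ _ _ _ _ _) (1 - a * q / u * q ^ n) nu => g Nu nu.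
by field; rewrite !parameter_neq0 nu.
Qed.

Lemma sum_vwp_term (k : int) (m : nat) :
  nablas [:: a; b * d / a; b * e / a; d * e / a] != 0 ->
  nablas [:: a / q; a / b; a / d; a / e; u / q] != 0 ->
  (forall i : nat, (i <= m)%N -> vwp_defined a b d e u (k + i)) ->
  \sum_(i < m.+1) vwp_term a b d e u (k + i)
  = lower_boundary a b d e u k - upper_boundary a b d e u (k + m)
    + contiguity_coef a b d e u
      * \sum_(i < m) vwp_term (a / q) b d e (u / q) (k + i.+1).
Proof.
move=> weight_neq0 coef_neq0; elim: m => [|m IHm] defd.
  by rewrite big_ord1 big_ord0 mulr0 !addr0 vwp_term_boundary.
rewrite big_ord_recr IHm /= => [|i le_im]; last exact/defd/leqW.
have kS : k + m.+1 = k + m + 1 by rewrite -addn1 PoszD addrA.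
have def_m : vwp_defined a b d e u (k + m) by apply: defd.
have def_Sm : vwp_defined a b d e u (k + m + 1) by rewrite -kS; apply: defd.
rewrite [in RHS]big_ord_recr /= mulrDr kS vwp_term_boundary //.
rewrite lower_boundary_contiguous //; ring.
Qed.

Corollary sum_vwp_term_symmetric (N : nat) :
  nablas [:: a; b * d / a; b * e / a; d * e / a] != 0 ->
  nablas [:: a / q; a / b; a / d; a / e; u / q] != 0 ->
  (forall n : int, - N.+1%:Z <= n <= N.+1%:Z -> vwp_defined a b d e u n) ->
  \sum_(i < (2 * N.+1).+1) vwp_term a b d e u (i%:Z - N.+1%:Z)
  = vwp_term a b d e u N.+1
    + lower_boundary a b d e u (- N.+1%:Z) - upper_boundary a b d e u N
    + contiguity_coef a b d e u
      * \sum_(i < (2 * N).+1) vwp_term (a / q) b d e (u / q) (i%:Z - N%:Z).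
Proof.
move=> weight_neq0 coef_neq0 defd.
have := @sum_vwp_term (- N.+1%:Z) (2 * N).+1 weight_neq0 coef_neq0.
have -> : - N.+1%:Z + (2 * N).+1 = N by lia.
move=> sum_lower; rewrite mulnS big_ord_recr /= addrC -!addrA; congr (_ + _).
  by congr vwp_term; lia.
under eq_bigr do rewrite addrC.
rewrite sum_lower => [|i le_i]; last by apply: defd; lia.
rewrite -addrA; congr (_ + (_ + _ * _)).
by apply: eq_bigr => i _; congr vwp_term; lia.
Qed.

Lemma reflection_identity (y : F) : y != 0 ->
  y ^+ 4 * ((1 - b * d * e / a / y)
    * ((1 - a / b / y) * (1 - a / d / y) * (1 - a / e / y)))
  = a ^+ 2 * ((1 - a / (b * d * e) * y)
    * ((1 - b / a * y) * (1 - d / a * y) * (1 - e / a * y))).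
Proof. by move=> y0; field; rewrite !parameter_neq0 y0. Qed.

Lemma lower_boundary_opp (m : nat) :
  lower_boundary a b d e u (- m%:Z)
  = contiguity_weight a b d e * a ^+ 2 * (1 - a / (b * d * e) * q ^+ m)
    * (qfacts q [:: b / a; d / a; e / a] m.+1 * qfact q (u / a) m
       / qfacts q [:: q / b; q / d; q / e; q / u] m)
    * (a ^+ 2 / (b * d * e * u)) ^+ m.
Proof.
have powers : (a * q / b ^+ 2) ^+ m * (a * q / d ^+ 2) ^+ m * (a * q / e ^+ 2) ^+ m
    * (a * q / u ^+ 2) ^+ m / (a ^+ 2 / (b * d * e * u)) ^+ m
    = (a ^+ 2 / (b * d * e * u)) ^+ m * (q ^+ m) ^+ 4.
  rewrite (exprAC q) -(exprVn _ m) -!exprMn; congr (_ ^+ m).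
  by field; rewrite !parameter_neq0.
rewrite /lower_boundary /boundary_core !wp_quot_opp // -!exprnN /qfacts.
rewrite !big_cons !big_nil !mulr1 !qfactSr.
pose quot := qfact q (b / a) m / qfact q (q / b) m
  * (qfact q (d / a) m / qfact q (q / d) m) * (qfact q (e / a) m / qfact q (q / e) m)
  * (qfact q (u / a) m / qfact q (q / u) m).
transitivity (contiguity_weight a b d e * quot
  * ((a ^+ 2 / (b * d * e * u)) ^+ m * (q ^+ m) ^+ 4) * ((1 - b * d * e / a / q ^+ m)
     * ((1 - a / b / q ^+ m) * (1 - a / d / q ^+ m) * (1 - a / e / q ^+ m)))).
  by rewrite -powers /quot; ring.
rewrite -[LHS]mulrA -[_ * _ ^+ 4 * _]mulrA.
by rewrite (reflection_identity _ (expf_neq0 m q0)) /quot !invfM; ring.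
Qed.

End VeryWellPoised.

Lemma wp_lowerE {F : fieldType} {q A B C D E : F} :
  q != 0 -> A != 0 -> B != 0 -> C != 0 -> D != 0 -> E != 0 ->
  (B * D * E * q / A * q / (B * q) = D * E * q / A)
  * (B * D * E * q / A * q / (D * q) = B * E * q / A)
  * (B * D * E * q / A * q / (E * q) = B * D * q / A)
  * (B * D * E * q / A * q / (B * C * D * E * q ^+ 2 / A ^+ 2) = A / C).
Proof.
by move=> q0 A0 B0 C0 D0 E0; do ?split; field; rewrite ?q0 ?A0 ?B0 ?C0 ?D0 ?E0.
Qed.

Lemma truncS_term_vwp {F : fieldType} (q A B C D E : F) (n : int) :
  q != 0 -> A != 0 -> B != 0 -> C != 0 -> D != 0 -> E != 0 ->
  truncS_term q B D E A C n
  = vwp_term q (B * D * E * q / A) (B * q) (D * q) (E * q)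
      (B * C * D * E * q ^+ 2 / A ^+ 2) n.
Proof.
move=> q0 A0 B0 C0 D0 E0; rewrite /truncS_term /vwp_term /wp_quot.
rewrite !(wp_lowerE q0 A0 B0 C0 D0 E0).
rewrite /qfacts !big_cons !big_nil !mulr1; congr (_ / _ * _ * _ ^ n).
- by rewrite expfzDr // expr1z [2 * n]mulrC -exprz_exp; ring.
- by rewrite !mulf_div !mulrA.
- by field; rewrite q0 A0 B0 C0 D0 E0.
Qed.

Section Reparametrization.

Context {F : fieldType} {q A B C D E : F}.
Hypotheses (q0 : q != 0) (A0 : A != 0) (B0 : B != 0) (C0 : C != 0).
Hypotheses (D0 : D != 0) (E0 : E != 0).

Local Notation a := (B * D * E * q / A).
Local Notation b := (B * q).
Local Notation d := (D * q).
Local Notation e := (E * q).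
Local Notation u := (B * C * D * E * q ^+ 2 / A ^+ 2).

Let lowerE := wp_lowerE q0 A0 B0 C0 D0 E0.

Lemma truncS_vwp (N : nat) :
  truncS q B D E N A C = \sum_(i < (2 * N).+1) vwp_term q a b d e u (i%:Z - N%:Z).
Proof. by apply: eq_bigr => i _; rewrite truncS_term_vwp. Qed.

Lemma truncS_contiguous_vwp (N : nat) :
  truncS q B D E N (A * q) (C * q)
  = \sum_(i < (2 * N).+1) vwp_term q (a / q) b d e (u / q) (i%:Z - N%:Z).
Proof.
apply: eq_bigr => i _; rewrite truncS_term_vwp ?mulf_neq0 //.
by congr vwp_term; field; rewrite q0 A0.
Qed.

Lemma truncS_defined_vwp (N : nat) (n : int) : truncS_defined q B D E N A C ->
  - N%:Z <= n <= N%:Z -> vwp_defined q a b d e u n.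
Proof.
move=> [_ defd] /defd[den]; rewrite /qfacts !big_cons big_nil mulr1.
rewrite !mulf_eq0 !negb_or => /and4P[lDE lBE lBD lAC].
by split; split; rewrite ?lowerE //; apply: den; rewrite !inE eqxx ?orbT.
Qed.

Lemma vwp_parameter_neq0 : [/\ a != 0, b != 0, d != 0, e != 0 & u != 0].
Proof. by split; rewrite !mulf_neq0 ?invr_eq0 ?expf_neq0 ?mulf_neq0. Qed.

Lemma vwp_parameterE :
  (b * d / a = A * q / E) * (b * e / a = A * q / D) * (d * e / a = A * q / B)
  * (a / q = B * D * E / A) * (u / q = B * C * D * E * q / A ^+ 2)
  * (a / b = D * E / A) * (a / d = B * E / A) * (a / e = B * D / A)
  * (b * d * e / a ^+ 2 = A ^+ 2 * q / (B * D * E))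
  * (b * d * e * u / a ^+ 2 = C * q ^+ 3)
  * (a ^+ 2 / (b * d * e * u) = (C * q ^+ 3)^-1)
  * (a ^+ 2 / (b * d * e) = B * D * E / (A ^+ 2 * q))
  * (a / (b * d * e) = (A * q ^+ 2)^-1)
  * (b / a = A / (D * E)) * (d / a = A / (B * E)) * (e / a = A / (B * D))
  * (u / a = C / A * q) * (q / b = 1 / B) * (q / d = 1 / D) * (q / e = 1 / E)
  * (q / u = A ^+ 2 / (B * C * D * E * q)).
Proof. by do ?split; field; rewrite ?q0 ?A0 ?B0 ?C0 ?D0 ?E0. Qed.

Lemma contiguity_coefE : contiguity_coef q a b d e u
  = A ^+ 2 * q / (B * D * E)
    * (nablas [:: B * D * E / A; C * q ^+ 3; B * D / A; B * E / A; D * E / A]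
       / nablas [:: a; B * C * D * E * q / A ^+ 2; A * q / B; A * q / D; A * q / E]).
Proof.
rewrite /contiguity_coef /contiguity_weight !vwp_parameterE /nablas /nabla.
by rewrite !big_cons !big_nil !mulr1 !invfM; ring.
Qed.

Lemma vwp_term_K1 (N : nat) :
  vwp_term q a b d e u N.+1
  = q ^ (N%:Z - 2) * nabla (B * D * E * q ^+ (2 * N + 3) / A)
    * qfacts q [:: B * q; D * q; E * q; B * C * D * E * q ^+ 2 / A ^+ 2] N.+1
    / K_den1 q N A B C D E / (C * q ^+ 3) ^+ N.
Proof.
rewrite -truncS_term_vwp // /K_den1 /truncS_term /nabla.
have -> : 2 * N.+1%:Z + 1 = (2 * N + 3)%N by lia.
rewrite -exprnP.
have -> : (1 / (C * q ^+ 2)) ^ N.+1 = q ^ (N%:Z - 2) / (C * (C * q ^+ 3) ^+ N).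
  have powM k : (C * q ^+ k) ^+ N = C ^+ N * (q ^+ N) ^+ k by rewrite exprMn exprAC.
  rewrite expfzDr // mul1r -!exprnP exprVn exprS !powM.
  rewrite (_ : q ^ (- 2) = (q ^+ 2)^-1) //.
  by field; rewrite !expf_neq0 // C0 q0.
rewrite /qfacts !big_cons !big_nil !mulr1 !invfM; ring.
Qed.

Lemma upper_boundary_K3 (N : nat) : upper_boundary q a b d e u N
  = A ^+ 2 * q / (B * D * E)
    * (nablas [:: B * q; D * q; E * q; B * D * E * q ^ (N%:Z - 1) / A ^+ 2]
       * qfacts q [:: B * C * D * E * q ^+ 2 / A ^+ 2;
                      B * q ^+ 2; D * q ^+ 2; E * q ^+ 2] N
       / K_den3 q N A B C D E) / (C * q ^+ 3) ^+ N.
Proof.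
have shift x : qfact q (x * q) N * (1 - x * q * q ^+ N)
    = (1 - x * q) * qfact q (x * q ^+ 2) N by rewrite -qfactSr qfactSl -mulrA.
have -> : B * D * E * q ^ (N%:Z - 1) / A ^+ 2 = B * D * E / (A ^+ 2 * q) * q ^+ N.
  by rewrite expfzDr // exprN1 -exprnP; field; rewrite q0 A0.
transitivity (A ^+ 2 * q / (B * D * E) * ((qfact q b N * (1 - b * q ^+ N))
  * (qfact q d N * (1 - d * q ^+ N)) * (qfact q e N * (1 - e * q ^+ N))
  * (1 - B * D * E / (A ^+ 2 * q) * q ^+ N) * qfact q u N / K_den3 q N A B C D E)
  / (C * q ^+ 3) ^+ N).
  rewrite /upper_boundary /boundary_core /contiguity_weight /wp_quot.
  rewrite !lowerE !vwp_parameterE /K_den3 /nablas /nabla /qfacts.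
  by rewrite !big_cons !big_nil !mulr1 -!exprnP exprVn !invfM; ring.
rewrite !shift /nablas /qfacts !big_cons !big_nil !mulr1 /nabla.
congr (_ * (_ / _) / _); ring.
Qed.

Lemma lower_boundary_K2 (N : nat) : 1 - C / A != 0 ->
  lower_boundary q a b d e u (- N.+1%:Z)
  = B * D * E * nabla (q ^ (N%:Z - 1) / A)
    * qfacts q [:: A / (B * D); A / (B * E); A / (D * E); C / A] N.+2
    / K_den2 q N A B C D E / (C * q ^+ 3) ^+ N.
Proof.
move=> CA; have [a0 b0 d0 e0 u0] := vwp_parameter_neq0.
rewrite lower_boundary_opp //.
have prefactor : A ^+ 2 * q / (B * D * E) * a ^+ 2 * (C * q ^+ 3)^-1 ^+ N.+1
    = B * D * E / (C * (C * q ^+ 3) ^+ N).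
  have : (C * q ^+ 3) ^+ N != 0 by rewrite !(expf_neq0, mulf_neq0).
  rewrite exprVn [_ ^+ N.+1]exprS; move: (_ ^+ N) => w w0.
  by field; rewrite q0 A0 B0 C0 D0 E0 w0.
have -> : q ^ (N%:Z - 1) / A = (A * q ^+ 2)^-1 * q ^+ N.+1.
  by rewrite expfzDr // exprN1 -exprnP [q ^+ N.+1]exprS; field; rewrite A0 q0.
transitivity (B * D * E / (C * (C * q ^+ 3) ^+ N)
  * ((1 - (A * q ^+ 2)^-1 * q ^+ N.+1)
     * (qfacts q [:: A / (B * D); A / (B * E); A / (D * E)] N.+2
        * qfact q (C / A * q) N.+1
        / (nablas [:: A * q / B; A * q / D; A * q / E; a]
           * qfacts q [:: 1 / B; 1 / D; 1 / E; A ^+ 2 / (B * C * D * E * q)] N.+1)))).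
  rewrite -prefactor /contiguity_weight !vwp_parameterE /nablas /nabla /qfacts.
  by rewrite !big_cons !big_nil !mulr1 exprVn !invfM; ring.
rewrite -[LHS](mulfK CA) /K_den2 /nablas /nabla /qfacts.
by rewrite !big_cons !big_nil !mulr1 (qfactSl _ (C / A)) !invfM; ring.
Qed.

Lemma K_boundary (N : nat) : 1 - C / A != 0 ->
  K q N A B C D E / (C * q ^+ 3) ^+ N
  = vwp_term q a b d e u N.+1 + lower_boundary q a b d e u (- N.+1%:Z)
    - upper_boundary q a b d e u N.
Proof.
move=> CA; rewrite vwp_term_K1 lower_boundary_K2 // upper_boundary_K3.
by rewrite -!mulrDl -mulrBl.
Qed.

Lemma vwp_weight_neq0 :
  nablas [:: a; B * C * D * E * q / A ^+ 2; A * q / B; A * q / D; A * q / E] != 0 ->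
  nablas [:: a; b * d / a; b * e / a; d * e / a] != 0.
Proof.
rewrite !vwp_parameterE /nablas !big_cons !big_nil !mulf_eq0 !negb_or oner_neq0.
by rewrite !andbT => /and5P[-> _ -> -> ->].
Qed.

Lemma vwp_coef_neq0 (N : nat) :
  truncS_defined q B D E N.+1 A C -> truncS_defined q B D E N (A * q) (C * q) ->
  nablas [:: a; B * C * D * E * q / A ^+ 2; A * q / B; A * q / D; A * q / E] != 0 ->
  nablas [:: a / q; a / b; a / d; a / e; u / q] != 0.
Proof.
move=> defS [aq _]; rewrite /nablas !big_cons !big_nil !mulr1.
rewrite !mulf_eq0 !negb_or => /and5P[_ uq _ _ _].
have [hb hd he _] : vwp_defined q a b d e u (-1).
  by apply: truncS_defined_vwp defS _; lia.
have ratio_neq0 x : wp_defined q a x (-1) -> 1 - a / x != 0.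
  exact: wp_defined_ratio_neq0.
rewrite /nabla (ratio_neq0 b) // (ratio_neq0 d) // (ratio_neq0 e) //.
rewrite !vwp_parameterE uq !andbT.
by move: aq; rewrite -mulf_div divff // mulr1.
Qed.

End Reparametrization.

Theorem theorem2p1 (R : realType) (q : R[i]) (hq : 0 < `|q| < 1) (N : nat)
  (A B C D E : R[i])
  (hA : A != 0) (hB : B != 0) (hC : C != 0) (hD : D != 0) (hE : E != 0)
  (hS1 : truncS_defined q B D E N.+1 A C)
  (hS2 : truncS_defined q B D E N (A * q) (C * q))
  (hK : K_defined q N A B C D E)
  (hcoef : nablas [:: B * D * E * q / A; B * C * D * E * q / A ^+ 2;
                      A * q / B; A * q / D; A * q / E] != 0) :
  truncS q B D E N.+1 A C =
    K q N A B C D E / (C * q ^+ 3) ^+ N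
    + A ^+ 2 * q / (B * D * E)
      * (nablas [:: B * D * E / A; C * q ^+ 3; B * D / A; B * E / A; D * E / A]
         / nablas [:: B * D * E * q / A; B * C * D * E * q / A ^+ 2;
                      A * q / B; A * q / D; A * q / E])
      * truncS q B D E N (A * q) (C * q).
Proof.
have q0 : q != 0 by case/andP: hq; rewrite normr_gt0.
have CA : 1 - C / A != 0.
  case: hK => _ K2 _; move: K2; rewrite /K_den2 /nablas big_cons.
  by rewrite !mulf_eq0 !negb_or => /andP[/and3P[]].
have [a0 b0 d0 e0 u0] := vwp_parameter_neq0 q0 hA hB hC hD hE.
rewrite truncS_vwp // truncS_contiguous_vwp // K_boundary // -contiguity_coefE //.
apply: sum_vwp_term_symmetric => //.
- exact: vwp_weight_neq0 hcoef.
- exact: vwp_coef_neq0 hS1 hS2 hcoef.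
- by move=> n; apply: truncS_defined_vwp hS1.
Qed.
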